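(* Let $k\ge 1$ and $n$ be integers with $n > \frac{9}{2}k^3 2^k$. Then \[ \alpha[J_{\pm}(n,k,0)] = 2\binom{n-1}{k-1}. \]
   Context: For integers $n\ge k\ge 1$ and $t$, $J_{\pm}(n,k,t)$ denotes the graph whose vertex set consists of all vectors in $\{-1,0,1\}^n$ with exactly $k$ nonzero coordinates, two vertices being joined by an edge if and only if their scalar product (standard inner product in $\mathbb{R}^n$) equals $t$. The independence number $\alpha[G]$ of a graph $G$ is the maximum size of an independent set, i.e. a set of vertices no two of which are joined by an edge. *)

(* Defs.v *)
From HB Require Import structures.
From mathcomp Require Import all_boot all_order all_algebra.

Set Implicit Arguments.
Unset Strict Implicit.
Unset Printing Implicit Defensive.

Import Order.TTheory GRing.Theory Num.Theory.

Local Open Scope ring_scope.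

Record sgraph := SGraph {
  svertex :> finType;
  sedge : rel svertex;
  sedge_sym : symmetric sedge;
  sedge_irrefl : irreflexive sedge }.

Definition independent (G : sgraph) (A : {set G}) : bool :=
  [forall x in A, forall y in A, ~~ sedge x y].

Definition alpha (G : sgraph) : nat :=
  \max_(A : {set G} | independent A) #|A|.

(* The finite subtype {-1, 0, 1} of int. *)
Definition trit : finType := seq_sub [:: -1; 0; 1 : int].

Definition int_of_trit (a : trit) : int := ssval a.

Definition supp (n : nat) (x : {ffun 'I_n -> trit}) : {set 'I_n} :=
  [set i | int_of_trit (x i) != 0].

Definition scalar_product (n : nat) (x y : {ffun 'I_n -> trit}) : int :=
  \sum_i int_of_trit (x i) * int_of_trit (y i).

Definition Jvertex (n k : nat) : finType :=
  {x : {ffun 'I_n -> trit} | #|supp x| == k}.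

(* Distinctness only matters when t = k, where every vertex has scalar
   product t with itself: it excludes loops. *)
Definition Jedge (n k : nat) (t : int) : rel (Jvertex n k) :=
  fun x y => (x != y) && (scalar_product (val x) (val y) == t).
Arguments Jedge : clear implicits.

Lemma Jedge_sym (n k : nat) (t : int) : symmetric (Jedge n k t).
Proof.
move=> x y; rewrite /Jedge eq_sym; congr (_ && (_ == _)).
by apply: eq_bigr => i _; rewrite mulrC.
Qed.

Lemma Jedge_irrefl (n k : nat) (t : int) : irreflexive (Jedge n k t).
Proof. by move=> x; rewrite /Jedge eqxx. Qed.

Definition Jpm (n k : nat) (t : int) : sgraph :=
  SGraph (@Jedge_sym n k t) (@Jedge_irrefl n k t).

(* Main.v *)
Require Import Defs.
From mathcomp Require Import all_boot all_order all_algebra.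
From mathcomp Require Import zify ring lra.

(* Lower bound: the vectors of constant sign on their support whose support
   contains a fixed point p have pairwise products +-|S :&: T| != 0.

   Upper bound: in an independent family the supports are pairwise
   intersecting. If they have no common point, there are at most
   k^2 C(n-2,k-2) of them, each carrying at most 2^k vectors, which is less
   than 2 C(n-1,k-1). If they all contain p, split the family by the value at p
   and show that each half B has at most C(n-1,k-1) elements. Call a coordinate
   mixed when both signs occur there in B. A vector of B with no mixed
   coordinate is determined by its support. If i is mixed, witnessed by x and
   y, every z in B with z_i <> 0 differs at i from x or from y, so its support
   meets theirs outside {p, i}, as otherwise the product would be 1 - 1 = 0;
   hence there are only O(C(n-3,k-3)) such z, fewer than the k-sets through p
   and i, even after accounting for the k-sets that contain several mixed
   coordinates. *)

Set Implicit Arguments.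
Unset Strict Implicit.
Unset Printing Implicit Defensive.

Import Order.TTheory GRing.Theory Num.Theory.

Local Open Scope ring_scope.

(** * Counting sets that contain a prescribed set *)

Lemma card_cover_leq (T I : finType) (F : {set T}) (J : {set I})
    (R : T -> I -> bool) :
  (forall x, x \in F -> exists2 j, j \in J & R x j) ->
  (#|F| <= \sum_(j in J) #|[set x in F | R x j]|)%N.
Proof.
move=> cov.
have -> : (\sum_(j in J) #|[set x in F | R x j]|
           = \sum_(j in J) \sum_(x in F) (if R x j then 1 else 0))%N.
  apply: eq_bigr => j _; rewrite -sum1_card -big_mkcondr /=.
  by apply: eq_bigl => x; rewrite inE.
rewrite -sum1_card exchange_big /=; apply: leq_sum => x /cov[j Jj Rxj].
by rewrite (bigD1 j) //= Rxj.
Qed.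

(** The number of k-subsets of an n-set through a fixed a-subset. The test is needed because
    subtraction is truncated: for [a > k] the binomial would be 1 instead of 0. *)
Definition nb_supersets (n k a : nat) : nat :=
  if (a <= k)%N then 'C(n - a, k - a) else 0.

Lemma card_supersets (T : finType) (k : nat) (A : {set T}) :
  #|[set S : {set T} | (A \subset S) && (#|S| == k)]|
    = nb_supersets #|T| k #|A|.
Proof.
rewrite /nb_supersets; case: leqP => [leAk | ltkA]; last first.
  apply/eqP; rewrite cards_eq0 -subset0; apply/subsetP => S; rewrite !inE.
  by case/andP=> /subset_leq_card + /eqP Sk; rewrite Sk leqNgt ltkA.
have -> : (#|T| - #|A|)%N = #|~: A| by rewrite [RHS]cardsCs setCK.
(* Removing [A] is a bijection onto the subsets of [~: A] of size [k - #|A|]. *)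
rewrite -cards_draws -(card_in_imset (f := fun S => S :\: A)); last first.
  move=> S S'; rewrite !inE => /andP[AS _] /andP[AS' _] /= eqD.
  by rewrite -(setID S A) -(setID S' A) eqD (setIidPr AS) (setIidPr AS').
apply: eq_card => S; rewrite [RHS]inE; apply/imsetP/andP.
  case=> S'; rewrite inE => /andP[AS' /eqP S'k] ->; split.
    by rewrite setDE subsetIr.
  by rewrite cardsD (setIidPr AS') S'k.
case=> SA /eqP Sk.
have dSA: S :&: A = set0.
  by apply/eqP; rewrite setI_eq0 disjoints_subset.
exists (A :|: S); last first.
  by rewrite setDUl setDv set0U setDE (setIidPl SA).
by rewrite inE subsetUl cardsU setIC dSA cards0 subn0 Sk subnKC ?eqxx.
Qed.

(** Each further prescribed point costs a factor (k-a)/(n-a), written without division. Every use of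
    the size of [n] goes through this ratio. *)
Lemma nb_supersetsS (n k a : nat) :
  ((n - a) * nb_supersets n k a.+1 = (k - a) * nb_supersets n k a)%N.
Proof.
rewrite /nb_supersets; case: ltngtP => [lt_ak | lt_ka | ->].
- have -> : (k - a = (k - a.+1).+1)%N by lia.
  by rewrite -mul_bin_diag subnS.
- by rewrite !muln0.
- by rewrite subnn muln0.
Qed.

(** * Vectors and their supports *)

Lemma trit_cases (a : trit) :
  [\/ int_of_trit a = -1, int_of_trit a = 0 | int_of_trit a = 1].
Proof.
have := ssvalP a; rewrite !inE => /or3P[] /eqP aE.
- by constructor 1.
- by constructor 2.
- by constructor 3.
Qed.

Lemma int_of_trit_inj : injective int_of_trit.
Proof. exact: val_inj. Qed.

Lemma mem_supp (n : nat) (x : {ffun 'I_n -> trit}) i :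
  (i \in supp x) = (int_of_trit (x i) != 0).
Proof. by rewrite inE. Qed.

(** Only [p] and [i] contribute: equal signs give 1 at [p], opposite signs give -1 at [i]. *)
Lemma scalar_product_eq0 (n : nat) (x y : {ffun 'I_n -> trit}) (p i : 'I_n) :
  x p = y p -> x i != y i -> p \in supp x -> i \in supp x -> i \in supp y ->
  supp x :&: supp y \subset [set p; i] -> scalar_product x y = 0.
Proof.
move=> eqp neqi; rewrite !mem_supp => xp0 xi0 yi0 /subsetP sub.
have ip : i != p by apply: contraNneq neqi => ->; rewrite eqp.
rewrite /scalar_product (bigD1 p) //= (bigD1 i) //= big1 => [|j /andP[jp ji]].
  have neqi' : int_of_trit (x i) <> int_of_trit (y i).
    by move=> /int_of_trit_inj /eqP; rewrite (negPf neqi).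
  move: xp0 xi0 yi0 neqi'; rewrite -eqp addr0.
  by case: (trit_cases (x p)) (trit_cases (x i)) (trit_cases (y i))
    => -> [] -> [] ->.
apply/eqP; rewrite mulf_eq0 -[_ || _]negbK negb_or.
have /implyP := sub j; rewrite !inE (negPf jp) (negPf ji) /= implybF.
by [].
Qed.

(* A vector is encoded by its support together with its set of [1]s. *)
Lemma card_leq_supp (n k : nat) (B : {set {ffun 'I_n -> trit}}) :
  (forall x, x \in B -> #|supp x| = k) ->
  (#|B| <= 2 ^ k * #|@supp n @: B|)%N.
Proof.
move=> Bk; rewrite -sum1_card (partition_big_imset (@supp n)) /=.
rewrite mulnC -sum_nat_const; apply: leq_sum => S /imsetP[x0 Bx0 ->].
rewrite sum1dep_card -(Bk _ Bx0) -card_powerset.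
pose ones (x : {ffun 'I_n -> trit}) := [set i | int_of_trit (x i) == 1].
rewrite -(card_in_imset (f := ones)) => [|x y].
  apply/subset_leq_card/subsetP => _ /imsetP[x + ->].
  rewrite !inE => /andP[_ /eqP <-]; apply/subsetP => i.
  by rewrite !inE => /eqP ->.
rewrite !inE => /andP[_ /eqP sx] /andP[_ /eqP sy] /setP eq1.
apply/ffunP => i; apply: int_of_trit_inj.
have := eq1 i; have /setP/(_ i) := etrans sx (esym sy); rewrite !inE.
by case: (trit_cases (x i)) (trit_cases (y i)) => -> [] ->.
Qed.

(** * Intersecting families of k-sets *)

Lemma card_hitting_supersets (T : finType) (k : nat) (F : {set {set T}})
    (A J : {set T}) :
  [disjoint A & J] ->
  (forall S, S \in F ->
     [/\ #|S| = k, A \subset S & exists2 j, j \in J & j \in S]) ->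
  (#|F| <= #|J| * nb_supersets #|T| k #|A|.+1)%N.
Proof.
move=> dAJ FP; apply: leq_trans (@card_cover_leq _ _ F J (fun S j => j \in S) _) _.
  by move=> S /FP[].
rewrite -sum_nat_const; apply: leq_sum => j Jj.
have -> : #|A|.+1 = #|j |: A|.
  by rewrite cardsU1 (disjointFl dAJ Jj).
rewrite -card_supersets; apply/subset_leq_card/subsetP => S.
by rewrite !inE subUset sub1set => /andP[/FP[-> -> _] ->]; rewrite eqxx.
Qed.

(** Fix a member [S0]; every member meets it in some [i]. Some member [S1] misses [i], so a member
    through [i] also contains a second point, taken from [S1]. This leaves k choices for each of two
    points. *)
Lemma card_nontrivial_intersecting (T : finType) (k : nat)
    (F : {set {set T}}) :
  (forall S, S \in F -> #|S| = k) ->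
  (forall S S', S \in F -> S' \in F -> exists2 j, j \in S & j \in S') ->
  (forall p, exists2 S, S \in F & p \notin S) ->
  (#|F| <= k * (k * nb_supersets #|T| k 2))%N.
Proof.
move=> Fk Fint Fnt; have [-> | [S0 FS0]] := set_0Vmem F; first by rewrite cards0.
apply: leq_trans (@card_cover_leq _ _ F S0 (fun S j => j \in S) _) _.
  by move=> S FS; apply: Fint.
rewrite -{1}(Fk _ FS0) -sum_nat_const; apply: leq_sum => i _.
have [S1 FS1 iS1] := Fnt i.
rewrite -{1}(Fk _ FS1) -(cards1 i); apply: card_hitting_supersets.
  by rewrite disjoints1.
move=> S; rewrite inE => /andP[FS iS].
by rewrite sub1set; split=> //; [apply: Fk | apply: Fint].
Qed.

(** * Families with a common nonzero value at a common point *)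

Section Star.

Variables (n k : nat) (B : {set {ffun 'I_n -> trit}}) (p : 'I_n) (s : trit).
Hypotheses (s_neq0 : int_of_trit s != 0)
  (B_k : forall x, x \in B -> #|supp x| = k)
  (B_p : forall x, x \in B -> x p = s)
  (B_indep : forall x y, x \in B -> y \in B -> x != y -> scalar_product x y != 0).

Let M : {set 'I_n} :=
  [set i | [exists x in B, exists y in B,
     [&& i \in supp x, i \in supp y & x i != y i]]].

Lemma star_mem_supp x : x \in B -> p \in supp x.
Proof. by move=> Bx; rewrite mem_supp B_p. Qed.

Lemma star_mixedP i : reflect
  (exists x y, [/\ x \in B, y \in B, i \in supp x, i \in supp y & x i != y i])
  (i \in M).
Proof.
rewrite inE; apply: (iffP exists_inP) => [[x Bx /exists_inP[y By]] |].
  by case/and3P=> ix iy neq; exists x, y.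
case=> x [y [Bx By ix iy neq]]; exists x => //; apply/exists_inP.
by exists y => //; apply/and3P.
Qed.

Lemma star_center_pure : p \notin M.
Proof.
by apply/negP => /star_mixedP[x [y [Bx By _ _]]]; rewrite !B_p // eqxx.
Qed.

Lemma card_star_mixed i : i \in M ->
  (#|[set z in B | i \in supp z]| <= 2 ^ k * (2 * k * nb_supersets n k 3))%N.
Proof.
move=> Mi; have [x [y [Bx By ix iy neq_xy]]] := star_mixedP _ Mi.
have pi : p != i by apply: contraNneq star_center_pure => ->.
apply: leq_trans (@card_leq_supp n k _ _) _ => [z|].
  by rewrite inE => /andP[/B_k].
rewrite leq_mul2l; apply/orP; right.
pose J := (supp x :|: supp y) :\: [set p; i].
apply: (@leq_trans (#|J| * nb_supersets n k 3)); last first.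
  rewrite leq_mul2r; apply/orP; right.
  apply: leq_trans (subset_leq_card (subsetDl _ _)) _.
  by apply: leq_trans (leq_card_setU _ _) _; rewrite !B_k //; lia.
have := @card_hitting_supersets _ k (@supp n @: [set z in B | i \in supp z])
  [set p; i] J.
rewrite cards2 pi card_ord; apply.
  by rewrite disjoint_sym disjoints_subset /J setDE subsetIr.
move=> _ /imsetP[z + ->]; rewrite inE => /andP[Bz iz]; split; first exact: B_k.
  by rewrite subUset !sub1set star_mem_supp.
(* As [x] and [y] differ at [i], at least one of them differs from [z] there. *)
have [w [Bw iw wJ neq_zw]] : exists w,
    [/\ w \in B, i \in supp w, supp w \subset supp x :|: supp y & z i != w i].
  have [eq_zx | neq_zx] := eqVneq (z i) (x i).
    by exists y; rewrite subsetUr eq_zx.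
  by exists x; rewrite subsetUl.
have neq : z != w by apply: contraNneq neq_zw => ->.
have [sub | /subsetPn[j]] := boolP (supp z :&: supp w \subset [set p; i]).
  have /eqP[] := B_indep Bz Bw neq.
  by apply: (scalar_product_eq0 (p := p) (i := i)); rewrite ?B_p ?star_mem_supp.
rewrite inE => /andP[jz jw] jA; exists j => //.
by rewrite /J in_setD jA (subsetP wJ).
Qed.

Let H := [set S : {set 'I_n} | ([set p] \subset S) && (#|S| == k)].

Lemma card_star_pure :
  (#|[set x in B | [disjoint supp x & M]]|
     <= #|[set S in H | [disjoint S & M]]|)%N.
Proof.
rewrite -(card_in_imset (f := @supp n)) => [|x y].
  apply/subset_leq_card/subsetP => _ /imsetP[x + ->].
  rewrite !inE sub1set => /andP[Bx ->].
  by rewrite star_mem_supp // B_k // eqxx.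
rewrite !inE => /andP[Bx dx] /andP[By _] sxy; apply/ffunP => i.
have [ix | ix] := boolP (i \in supp x).
  apply/eqP; apply: contraFT (disjointFr dx ix) => neq.
  by apply/star_mixedP; exists x, y; split; rewrite -?sxy.
have iy : i \notin supp y by rewrite -sxy.
move: ix iy; rewrite !mem_supp !negbK => /eqP ix /eqP iy.
by apply: int_of_trit_inj; rewrite ix iy.
Qed.

(** Double counting of the pairs [i \in S] with [i] mixed: a k-set through [p] contains at most k-1
    mixed coordinates, since [p] is not mixed. *)
Lemma card_star_hitting :
  (#|M| * nb_supersets n k 2
     <= (k - 1) * #|[set S in H | ~~ [disjoint S & M]]|)%N.
Proof.
set H' := [set S in H | _].
have -> : (#|M| * nb_supersets n k 2
           = \sum_(i in M) \sum_(S in H') (if i \in S then 1 else 0))%N.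
  rewrite -sum_nat_const; apply: eq_bigr => i Mi.
  have pi : p != i by apply: contraNneq star_center_pure => ->.
  rewrite -big_mkcondr /= sum1dep_card.
  have := card_supersets k [set p; i]; rewrite cards2 pi card_ord => <-.
  apply: eq_card => S; rewrite !inE subUset !sub1set.
  have [iS|] := boolP (i \in S); rewrite ?andbF // !andbT.
  case: (p \in S) => //=; case: (#|S| == k) => //=.
  by apply/esym/pred0Pn; exists i; rewrite /= iS.
rewrite exchange_big mulnC -sum_nat_const; apply: leq_sum => S.
rewrite !inE sub1set => /andP[/andP[pS /eqP <-] _].
rewrite -big_mkcondr /= sum1dep_card.
have -> : (#|S| - 1)%N = #|S :\ p| by rewrite (cardsD1 p S) pS add1n subn1.
apply/subset_leq_card/subsetP => i; rewrite inE in_setD1 => /andP[Mi ->].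
by rewrite andbT; apply: contraTneq Mi => ->; exact: star_center_pure.
Qed.

(** The k-sets through [p] that avoid [M] pay for the pure vectors, those that meet [M] pay for all
    the others. *)
Lemma card_star_leq :
  (2 < n)%N -> (2 ^ k * (2 * k) * ((k - 1) * (k - 2)) <= n - 2)%N ->
  (#|B| <= nb_supersets n k 1)%N.
Proof.
move=> n_gt2 n_large; set E := (2 ^ k * (2 * k * nb_supersets n k 3))%N.
pose pure := [set x in B | [disjoint supp x & M]].
have le_mixed : (#|B :\: pure| <= #|M| * E)%N.
  apply: leq_trans (@card_cover_leq _ _ (B :\: pure) M (fun z i => i \in supp z) _) _.
    move=> x; rewrite !inE => /andP[+ Bx]; rewrite Bx /= => /pred0Pn[i].
    by case/andP => ix Mi; exists i.
  rewrite -sum_nat_const; apply: leq_sum => i Mi.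
  apply: leq_trans (card_star_mixed Mi); apply/subset_leq_card/subsetP => z.
  by rewrite !inE => /andP[/andP[_ ->] ->].
(* Going from three prescribed points to two gains (n-2)/(k-2), which absorbs the other factors of
   [E] by the bound on [n]. *)
have le_E : ((k - 1) * E <= nb_supersets n k 2)%N.
  rewrite -(leq_pmul2l (m := n - 2)) ?subn_gt0 //.
  have -> : ((n - 2) * ((k - 1) * E)
      = 2 ^ k * (2 * k) * (k - 1) * ((n - 2) * nb_supersets n k 3))%N.
    by rewrite /E; ring.
  by rewrite nb_supersetsS mulnA leq_mul2r -mulnA n_large orbT.
have le_H : (#|M| * E <= #|[set S in H | ~~ [disjoint S & M]]|)%N.
  (* For [k <= 1] the factor k-1 cannot be cancelled, but then [E] is 0, as no k-set has three
     points. *)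
  have [le_k1 | lt1k] := leqP k 1.
    have -> : E = 0%N.
      by rewrite /E /nb_supersets leqNgt ltnS (leq_trans le_k1) // !muln0.
    by rewrite muln0.
  rewrite -(leq_pmul2l (m := k - 1)) ?subn_gt0 //.
  by apply: leq_trans card_star_hitting; rewrite mulnCA leq_mul2l le_E orbT.
have := card_supersets k [set p]; rewrite card_ord cards1 => <-.
rewrite -/H -(cardsID pure B).
rewrite -(cardsID [set S : {set 'I_n} | [disjoint S & M]] H).
apply: leq_add; last first.
  apply: leq_trans le_mixed (leq_trans le_H _).
  by apply/subset_leq_card/subsetP => S; rewrite !inE andbC.
apply: leq_trans (leq_trans card_star_pure _).
  exact: subset_leq_card (subsetIr _ _).
by apply/subset_leq_card/subsetP => S; rewrite !inE.
Qed.

End Star.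

(** * Upper bound for independent families *)

Definition sign_trit (b : bool) : trit :=
  if b then @SeqSub _ [:: -1; 0; 1 : int] 1 isT
  else @SeqSub _ [:: -1; 0; 1 : int] (-1) isT.

Definition zero_trit : trit := @SeqSub _ [:: -1; 0; 1 : int] 0 isT.

Lemma int_of_sign_trit b : int_of_trit (sign_trit b) = (-1) ^+ (~~ b).
Proof. by case: b. Qed.

Lemma trit_neq0P (a : trit) :
  int_of_trit a != 0 -> exists b, a = sign_trit b.
Proof.
case: (trit_cases a) => aE; rewrite aE // => _.
  by exists false; apply: int_of_trit_inj.
by exists true; apply: int_of_trit_inj.
Qed.

Lemma card_indep_leq (n k : nat) (B : {set {ffun 'I_n -> trit}}) :
  (0 < k)%N -> (9 * k ^ 3 * 2 ^ k < 2 * n)%N ->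
  (forall x, x \in B -> #|supp x| = k) ->
  (forall x y, x \in B -> y \in B -> x != y -> scalar_product x y != 0) ->
  (#|B| <= 2 * nb_supersets n k 1)%N.
Proof.
move=> k_gt0 n_large Bk Bindep.
have Q_gt0 : (0 < 2 ^ k)%N by rewrite expn_gt0.
have P_gt0 : (0 < k ^ 3 * 2 ^ k)%N by rewrite muln_gt0 expn_gt0 k_gt0.
have n_gt2 : (2 < n)%N by lia.
have [/existsP[p /forall_inP Bp] | nstar] :=
  boolP [exists p, forall x in B, p \in supp x].
  pose Bs b := [set x in B | x p == sign_trit b].
  have le_Bs b : (#|Bs b| <= nb_supersets n k 1)%N.
    apply: (@card_star_leq _ _ _ p (sign_trit b)) => //.
    - by rewrite int_of_sign_trit signr_eq0.
    - by move=> x; rewrite inE => /andP[/Bk].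
    - by move=> x; rewrite inE => /andP[_ /eqP].
    - by move=> x y; rewrite !inE => /andP[Bx _] /andP[By _]; apply: Bindep.
    - move: n_large P_gt0 Q_gt0; rewrite !expnS expn0.
      set Q := (2 ^ k)%N; nia.
  rewrite mul2n -addnn; apply: leq_trans (leq_add (le_Bs true) (le_Bs false)).
  apply: leq_trans (leq_card_setU _ _); apply/subset_leq_card/subsetP => x Bx.
  have := Bp _ Bx; rewrite mem_supp => /trit_neq0P[[] xE];
    by rewrite !inE Bx xE eqxx ?orbT.
apply: leq_trans (card_leq_supp Bk) _.
have := @card_nontrivial_intersecting _ k (@supp n @: B).
rewrite card_ord => le_supp.
apply: (@leq_trans (2 ^ k * (k * (k * nb_supersets n k 2)))).
  rewrite leq_mul2l le_supp ?orbT //.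
  - by move=> _ /imsetP[x Bx ->]; apply: Bk.
  - move=> _ _ /imsetP[x Bx ->] /imsetP[y By ->].
    (* Independence says nothing about a vector and itself; there [k > 0] makes the support
       nonempty. *)
    have [<- | neq] := eqVneq x y.
      have /card_gt0P[i ix] : (0 < #|supp x|)%N by rewrite Bk.
      by exists i.
    have [dxy | /pred0Pn[i /andP[ix iy]]] := boolP [disjoint supp x & supp y].
      have /eqP[] := Bindep _ _ Bx By neq.
      apply: big1 => i _; apply/eqP; rewrite mulf_eq0.
      have [ix | ] := boolP (i \in supp x); last by rewrite mem_supp negbK => ->.
      by have := disjointFr dxy ix; rewrite mem_supp => /negbFE ->; rewrite orbT.
    by exists i.
  move=> p; move: nstar; rewrite negb_exists => /forallP/(_ p).
  rewrite negb_forall_in => /exists_inP[x Bx px].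
  by exists (supp x) => //; apply: imset_f.
(* Multiplying by n-1 trades two prescribed points for one; what remains is 2^k k^2 (k-1) <=
   2(n-1). *)
rewrite -(leq_pmul2l (m := n - 1)) ?subn_gt0; last by lia.
have -> : ((n - 1) * (2 ^ k * (k * (k * nb_supersets n k 2)))
    = 2 ^ k * k * k * ((n - 1) * nb_supersets n k 2))%N by ring.
rewrite nb_supersetsS !mulnA leq_mul2r; apply/orP; right.
move: n_large P_gt0 Q_gt0; rewrite !expnS expn0; set Q := (2 ^ k)%N; nia.
Qed.

(** * Lower bound from vectors of constant sign *)

Definition sign_vec (n : nat) (b : bool) (S : {set 'I_n}) : {ffun 'I_n -> trit} :=
  [ffun i => if i \in S then sign_trit b else zero_trit].

Lemma int_of_sign_vec (n : nat) b (S : {set 'I_n}) i :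
  int_of_trit (sign_vec b S i) = (-1) ^+ (~~ b) * (i \in S)%:R.
Proof.
rewrite ffunE; case: (i \in S); last by rewrite mulr0n mulr0.
by rewrite mulr1n mulr1 int_of_sign_trit.
Qed.

Lemma supp_sign_vec (n : nat) b (S : {set 'I_n}) : supp (sign_vec b S) = S.
Proof.
apply/setP => i; rewrite mem_supp int_of_sign_vec mulf_eq0 signr_eq0 /=.
by case: (i \in S).
Qed.

Lemma scalar_product_sign_vec (n : nat) b c (S T : {set 'I_n}) :
  scalar_product (sign_vec b S) (sign_vec c T)
    = (-1) ^+ (~~ b) * (-1) ^+ (~~ c) * #|S :&: T|%:R.
Proof.
rewrite -sum1_card natr_sum big_mkcond mulr_sumr /=; apply: eq_bigr => i _.
rewrite !int_of_sign_vec mulrACA in_setI.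
by case: (i \in S); case: (i \in T); rewrite ?mulr0n ?mulr1n ?mulr0 ?mul0r ?mulr1.
Qed.

Lemma alpha_geq (n k : nat) (p : 'I_n) :
  (2 * nb_supersets n k 1 <= alpha (Jpm n k 0))%N.
Proof.
pose F : {set Jpm n k 0} := [set v | (p \in supp (val v)) &&
  [exists b, val v == sign_vec b (supp (val v))]].
have indF : independent F.
  apply/forall_inP => x; rewrite inE => /andP[px /existsP[b /eqP xE]].
  apply/forall_inP => y; rewrite inE => /andP[py /existsP[c /eqP yE]].
  rewrite /= /Jedge negb_and; apply/orP; right.
  rewrite xE yE scalar_product_sign_vec !mulf_eq0 !signr_eq0 /= pnatr_eq0.
  by rewrite cards_eq0; apply/set0Pn; exists p; rewrite inE px.
apply: leq_trans (leq_bigmax_cond _ indF).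
pose H := [set S : {set 'I_n} | ([set p] \subset S) && (#|S| == k)].
have <- : #|setX [set: bool] H| = (2 * nb_supersets n k 1)%N.
  by rewrite cardsX cardsT card_bool card_supersets card_ord cards1.
rewrite -(card_imset _ val_inj).
(* A pair of a sign and a k-set through [p] is recovered from its vector: the set is the support,
   the sign is read at [p]. *)
rewrite -(card_in_imset (f := fun bS => sign_vec bS.1 bS.2)).
  apply/subset_leq_card/subsetP => _ /imsetP[[b S] + ->].
  rewrite !inE sub1set /= => /andP[pS Sk].
  have vk : #|supp (sign_vec b S)| == k by rewrite supp_sign_vec.
  apply/imsetP; exists (exist _ (sign_vec b S) vk : Jvertex n k) => //.
  by rewrite inE supp_sign_vec pS; apply/existsP; exists b.
move=> [b S] [c T]; rewrite !inE sub1set /= => /andP[pS _] _ eqv.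
have eqS : S = T by rewrite -(supp_sign_vec b S) eqv supp_sign_vec.
have := congr1 (fun v : {ffun 'I_n -> trit} => int_of_trit (v p)) eqv.
by rewrite /= !int_of_sign_vec -eqS pS; case: b {eqv}; case: c.
Qed.

Theorem theorem9 (k n : nat) (k_ge1 : (1 <= k)%N)
    (n_gt : 9 / 2 * k%:R ^+ 3 * 2 ^+ k < n%:R :> rat) :
  alpha (Jpm n k 0) = (2 * 'C(n - 1, k - 1))%N.
Proof.
have n_large : (9 * k ^ 3 * 2 ^ k < 2 * n)%N.
  (* Clearing the denominator of 9/2 moves the hypothesis from rationals to naturals. *)
  rewrite -(ltr_nat rat) !natrM !natrX; lra.
have -> : 'C(n - 1, k - 1) = nb_supersets n k 1 by rewrite /nb_supersets k_ge1.
have p : 'I_n by exists 0%N; lia.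
apply/eqP; rewrite eqn_leq alpha_geq // andbT.
apply/bigmax_leqP => A /forall_inP indA.
rewrite -(card_imset _ val_inj); apply: card_indep_leq => //.
  by move=> _ /imsetP[x _ ->]; apply/eqP/(valP x).
move=> _ _ /imsetP[x Ax ->] /imsetP[y Ay ->] neq.
have /forall_inP/(_ _ Ay) := indA _ Ax; rewrite /= /Jedge.
by have -> : x != y by apply: contraNneq neq => ->.
Qed.
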